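(* Let $G=([n],E)$ be a connected simple graph with $n\geq 2$ vertices, let $k\in[n]$, and let $V'=[n]\setminus\{k\}$. Let $\Sigma=(\sigma_{ij})_{i,j\in V'}$ be a symmetric matrix of variables ($\sigma_{ij}=\sigma_{ji}$), and for $i,j\in V'$ let $\Sigma_{\widehat i,\widehat j}$ be the matrix obtained from $\Sigma$ by deleting the row indexed by $i$ and the column indexed by $j$. Let $$\mathcal{R}_k=\left\{\det\Sigma_{\widehat i,\widehat j} : i,j\in V',\ i\neq j,\ (i,j)\notin E\right\}\cup\left\{\sum_{i\in V'}(-1)^{i+j}\det\Sigma_{\widehat i,\widehat j} : j\in V',\ (j,k)\notin E\right\},$$ where in the sign $(-1)^{i+j}$ the indices $i,j$ stand for the positions of the corresponding row and column in $\Sigma$. Then the vanishing ideal $I(\mathcal{M}(G,k)^{-1})\subseteq\mathbb{C}[\sigma_{ij}]$ of the covariance model $\mathcal{M}(G,k)^{-1}$ equals the saturation $\langle\mathcal{R}_k\rangle:\langle\det(\Sigma)\rangle^{\infty}$.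
   Context: Attach to each edge $e\in E$ a variable $x_e$. The Laplacian $L(G)(\mathbf{x}_E)$ is the symmetric $n\times n$ matrix with off-diagonal entries $-x_{ij}$ if $ij\in E$ and $0$ if $i\neq j$, $ij\notin E$, and with diagonal entries $\sum_{j:\,ij\in E}x_{ij}$. For a vertex $k$, $L(G)_{\widehat k,\widehat k}$ is $L(G)$ with row and column $k$ deleted, and $\mathcal{M}(G,k)=\{L(G)_{\widehat k,\widehat k}(\mathbf{x}_E) : \mathbf{x}_E\in\mathbb{C}^{E}\}$, a linear space of complex symmetric $(n-1)\times(n-1)$ matrices with rows and columns indexed by $[n]\setminus\{k\}$. The covariance model $\mathcal{M}(G,k)^{-1}$ is the Zariski closure, in the space of complex symmetric $(n-1)\times(n-1)$ matrices, of the set of invertible symmetric matrices $\Sigma$ with $\Sigma^{-1}\in\mathcal{M}(G,k)$. Its vanishing ideal is the set of polynomials in the $\sigma_{ij}$ vanishing on it. For ideals, $I:\langle g\rangle^\infty=\{f : g^m f\in I\text{ for some }m\ge 0\}$. *)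

(* Defs.v *)
From HB Require Import structures.
From mathcomp Require Import all_boot all_order all_algebra.
From mathcomp Require Export mpoly complex.
From mathcomp Require Export reals.

Set Implicit Arguments.
Unset Strict Implicit.
Unset Printing Implicit Defensive.

Import Order.TTheory GRing.Theory Num.Theory.
Local Open Scope ring_scope.

(* A simple graph on the vertex set 'I_n is its set E of edges, each edge being
   a two-element set of vertices. *)
Definition simple_graph (n : nat) (E : {set {set 'I_n}}) : Prop :=
  forall A, A \in E -> #|A| = 2.

Definition adj (n : nat) (E : {set {set 'I_n}}) : rel 'I_n :=
  fun i j => [set i; j] \in E.

Definition connected_graph (n : nat) (E : {set {set 'I_n}}) : Prop :=
  forall i j, connect (adj E) i j.

(* Only the values of x on E are used, so x stands for a vector in K^E. *)
Definition laplacian (K : fieldType) (n : nat) (E : {set {set 'I_n}})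
    (x : {set 'I_n} -> K) : 'M[K]_n :=
  \matrix_(i, j)
    if i == j then \sum_(l | adj E i l) x [set i; l]
    else if adj E i j then - x [set i; j] else 0.

(* V' = [n] \ {k} is represented by 'I_n.-1 through the increasing bijection
   lift k, so that an element of 'I_n.-1 is a position in Sigma. *)
Definition reduced_laplacians (K : fieldType) (n : nat) (E : {set {set 'I_n}})
    (k : 'I_n) (A : 'M[K]_n.-1) : Prop :=
  exists x : {set 'I_n} -> K, A = row' k (col' k (laplacian E x)).

(* The coordinates sigma_ij of the space of symmetric m x m matrices are
   indexed by the pairs i <= j. *)
Notation sym_index m := {p : 'I_m * 'I_m | (p.1 <= p.2)%N}.

Notation symdim m := #|{: sym_index m}|.

Notation sympoly K m := {mpoly K[symdim m]}.

Lemma sym_pair_subproof (m : nat) (i j : 'I_m) :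
  let p := if (i <= j)%N then (i, j) else (j, i) in (p.1 <= p.2)%N.
Proof. by case: (leqP i j) => //= /ltnW. Qed.

Definition sym_pair (m : nat) (i j : 'I_m) : sym_index m :=
  Sub (if (i <= j)%N then (i, j) else (j, i)) (sym_pair_subproof i j).

Definition generic_sym (K : fieldType) (m : nat) : 'M[sympoly K m]_m :=
  \matrix_(i, j) 'X_(enum_rank (sym_pair i j)).

Definition symmetric_mx (K : fieldType) (m : nat) (S : 'M[K]_m) : Prop :=
  S^T = S.

(* The value of f under sigma_ij := S i j, for S symmetric. *)
Definition sym_eval (K : fieldType) (m : nat) (f : sympoly K m)
    (S : 'M[K]_m) : K :=
  f.@[fun v => let p := val (enum_val v) in S p.1 p.2].

Definition zero_locus (K : fieldType) (m : nat) (F : sympoly K m -> Prop)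
    (S : 'M[K]_m) : Prop :=
  symmetric_mx S /\ forall f, F f -> sym_eval f S = 0.

(* The intersection of all Zariski closed sets of symmetric matrices that
   contain X. *)
Definition zariski_closure (K : fieldType) (m : nat) (X : 'M[K]_m -> Prop)
    (S : 'M[K]_m) : Prop :=
  forall F : sympoly K m -> Prop,
    (forall T, X T -> zero_locus F T) -> zero_locus F S.

Definition vanishing_ideal (K : fieldType) (m : nat) (X : 'M[K]_m -> Prop)
    (f : sympoly K m) : Prop :=
  forall S, X S -> sym_eval f S = 0.

Definition covariance_model (K : fieldType) (n : nat) (E : {set {set 'I_n}})
    (k : 'I_n) : 'M[K]_n.-1 -> Prop :=
  zariski_closure (fun S => [/\ symmetric_mx S, S \in unitmx
                              & reduced_laplacians E k (invmx S)]).

Definition ideal_gen (A : comNzRingType) (G : A -> Prop) (f : A) : Prop :=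
  exists s : seq (A * A),
    (forall p, p \in s -> G p.2) /\ f = \sum_(p <- s) p.1 * p.2.

Definition saturation (A : comNzRingType) (I : A -> Prop) (g f : A) : Prop :=
  exists m : nat, I (g ^+ m * f).

Definition relations (K : fieldType) (n : nat) (E : {set {set 'I_n}})
    (k : 'I_n) (f : sympoly K n.-1) : Prop :=
  let Sigma := generic_sym K n.-1 in
  (exists i j : 'I_n.-1,
     [/\ i != j, ~~ adj E (lift k i) (lift k j)
       & f = \det (row' i (col' j Sigma))]) \/
  (exists j : 'I_n.-1,
     ~~ adj E (lift k j) k /\
     f = \sum_(i < n.-1) (-1) ^+ (i + j) * \det (row' i (col' j Sigma))).

(* Main.v *)
(** Write [d] for the determinant of the generic symmetric matrix [Sigma].
    Modulo the relations, the adjugate of [Sigma] is entrywise congruent to a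
    reduced Laplacian [L] whose weights are read off from the adjugate itself:
    the first family of relations kills its entries at non-edges, the second
    one the row sums at vertices not adjacent to [k].  Hence
    [d * det L = d ^ m] and [d ^ 2 * adj L = (d * det L) * Sigma] modulo the
    relations, so that [Sigma] is congruent to the fraction
    [(d ^ 2 * adj L) / (d * det L)].  At every point where the denominator does
    not vanish, this fraction is [d * L^-1], a point of the model.  If [f]
    vanishes on the model, then substituting the fraction into [f] and clearing
    denominators gives a polynomial which, multiplied by [d * det L], vanishes
    everywhere, hence is zero; it is also congruent to a power of [d] times
    [f]. *)

Require Import Defs.
From HB Require Import structures.
From mathcomp Require Import all_boot all_order all_algebra ring.
From mathcomp Require Import mpoly complex reals.

Set Implicit Arguments.
Unset Strict Implicit.
Unset Printing Implicit Defensive.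

Import Order.TTheory GRing.Theory Num.Theory.
Local Open Scope ring_scope.

(** * Polynomials in characteristic zero that vanish at every point *)

Section PolynomialFunctions.
Variable K : numFieldType.

Lemma poly_horner_eq0 (p : {poly K}) : (forall x, p.[x] = 0) -> p = 0.
Proof.
move=> p0; apply/eqP/negPn/negP => pN0.
(* In characteristic zero the first [size p] naturals are distinct roots, one more than the degree
   allows. *)
pose s : seq K := [seq i%:R | i <- iota 0 (size p)].
have us : uniq s by rewrite map_inj_uniq ?iota_uniq //; apply: mulrIn; rewrite oner_eq0.
have rs : all (root p) s by apply/allP => x _; rewrite rootE p0.
by have := max_poly_roots pN0 rs us; rewrite size_map size_iota ltnn.
Qed.

Lemma meval_muni N (p : {mpoly K[N.+1]}) (v : 'I_N.+1 -> K) :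
  p.@[v] = (map_poly (meval (fun i => v (widen_ord (leqnSn N) i))) (muni p)).[v ord_max].
Proof.
rewrite mevalE muniE rmorph_sum horner_sum; apply: eq_bigr => m _.
rewrite /= -!mul_polyC rmorphM /= map_polyC map_polyXn hornerCM hornerXn /=.
rewrite mevalZ mevalX big_ord_recr /= mulrA.
by under [in RHS]eq_bigr do rewrite mnmE.
Qed.

Lemma mcoeff_muni N (p : {mpoly K[N.+1]}) (m : 'X_{1..N.+1}) :
  p@_m = ((muni p)`_(m ord_max))@_[multinom m (widen_ord (leqnSn N) i) | i < N].
Proof.
rewrite muniE coef_sum raddf_sum /= {1}[p]mpolyE raddf_sum /=.
apply: eq_bigr => m' _; rewrite coefZ coefXn mcoeffZ mcoeffX.
have [->|mN] := eqVneq m' m; first by rewrite !eqxx !mulr1 mcoeffZ mcoeffX eqxx mulr1.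
rewrite mulr0; case: eqP => [e|_]; last by rewrite mulr0 mcoeff0.
rewrite mulr1 mcoeffZ mcoeffX; case: eqP => [/mnmP e'|_]; last by rewrite mulr0.
case/eqP: mN; apply/mnmP => i; case: (unliftP ord_max i) => [j ->|->] //.
have := e' j; rewrite !mnmE.
suff -> : lift ord_max j = widen_ord (leqnSn N) j by [].
by apply: val_inj; rewrite /= /bump leqNgt ltn_ord.
Qed.

(** Induction on the number of variables: once the others are fixed at [w], the polynomial in the
    last variable vanishes identically, so each of its coefficients vanishes at every [w]. *)
Lemma mpoly_meval_eq0 N (p : {mpoly K[N]}) : (forall v, p.@[v] = 0) -> p = 0.
Proof.
elim: N p => [|N IH] p p0.
  apply/mpolyP => m; rewrite mcoeff0.
  have m0 (m' : 'X_{1..0}) : m' = 0%MM by apply/mnmP; case.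
  have := p0 (fun=> 0); rewrite {1}[p]mpolyE raddf_sum /= => <-.
  rewrite {1}[p]mpolyE raddf_sum /=; apply: eq_bigr => m' _.
  by rewrite mevalZ mevalX big_ord0 mcoeffZ mcoeffX [m]m0 (m0 m') eqxx.
apply/mpolyP => m; rewrite mcoeff_muni mcoeff0.
rewrite [X in X@__](_ : _ = 0) ?mcoeff0 //; apply: IH => w.
pose u x (i : 'I_N.+1) := if unlift ord_max i is Some j then w j else x : K.
have uw x i : u x (widen_ord (leqnSn N) i) = w i.
  suff -> : widen_ord (leqnSn N) i = lift ord_max i by rewrite /u liftK.
  by apply: val_inj; rewrite /= /bump leqNgt ltn_ord.
have q0 : map_poly (meval w) (muni p) = 0.
  apply: poly_horner_eq0 => x; rewrite -(p0 (u x)) meval_muni.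
  rewrite [X in _ = _.[X]](_ : _ = x); last by rewrite /u unlift_none.
  congr (_.[_]); apply: eq_map_poly => f.
  by apply: meval_eq => i; rewrite uw.
by rewrite -(coef_map (meval w)) q0 coef0.
Qed.

End PolynomialFunctions.

(** * Congruence modulo a generated ideal, and its effect on determinants and adjugates *)

Section Congruence.
Variables (A : comNzRingType) (G : A -> Prop).
Let I := ideal_gen G.

Lemma ideal_gen_sub g : G g -> I g.
Proof.
by exists [:: (1, g)]; split=> [p|]; rewrite ?inE ?big_seq1 ?mul1r // => /eqP ->.
Qed.

Lemma ideal_gen0 : I 0.
Proof. by exists [::]; rewrite big_nil. Qed.

Lemma ideal_genD f g : I f -> I g -> I (f + g).
Proof.
case=> s [sG ->] [t [tG ->]]; exists (s ++ t); rewrite big_cat; split=> // p.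
by rewrite mem_cat => /orP[/sG|/tG].
Qed.

Lemma ideal_genM a f : I f -> I (a * f).
Proof.
case=> s [sG ->]; exists [seq (a * p.1, p.2) | p <- s]; split.
  by move=> _ /mapP[p /sG ? ->].
by rewrite big_map mulr_sumr; apply: eq_bigr => p _; rewrite mulrA.
Qed.

Lemma ideal_genN f : I f -> I (- f).
Proof. by rewrite -mulN1r; exact: ideal_genM. Qed.

Lemma ideal_gen_sum (T : Type) (r : seq T) (P : pred T) (F : T -> A) :
  (forall i, P i -> I (F i)) -> I (\sum_(i <- r | P i) F i).
Proof.
by move=> FI; apply: big_ind => //; [exact: ideal_gen0|exact: ideal_genD].
Qed.

Definition congr_mod f g := I (f - g).

Lemma congr_mod_refl f : congr_mod f f.
Proof. by rewrite /congr_mod subrr; exact: ideal_gen0. Qed.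

Lemma congr_mod_sym f g : congr_mod f g -> congr_mod g f.
Proof. by move/ideal_genN; rewrite opprB. Qed.

Lemma congr_mod_ideal f g : congr_mod f g -> I f -> I g.
Proof.
move=> fg fI; rewrite (_ : g = f - (f - g)); last by ring.
by apply: ideal_genD => //; exact: ideal_genN.
Qed.

Lemma congr_modM f f' g g' :
  congr_mod f f' -> congr_mod g g' -> congr_mod (f * g) (f' * g').
Proof.
move=> ff gg; rewrite /congr_mod.
rewrite (_ : _ - _ = g * (f - f') + f' * (g - g')); last by ring.
by apply: ideal_genD; exact: ideal_genM.
Qed.

Lemma congr_mod_sum (T : Type) (r : seq T) (F F' : T -> A) :
  (forall i, congr_mod (F i) (F' i)) ->
  congr_mod (\sum_(i <- r) F i) (\sum_(i <- r) F' i).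
Proof. by move=> FF; rewrite /congr_mod -sumrB; apply: ideal_gen_sum => i _; exact: FF. Qed.

Lemma congr_mod_prod (T : Type) (r : seq T) (F F' : T -> A) :
  (forall i, congr_mod (F i) (F' i)) ->
  congr_mod (\prod_(i <- r) F i) (\prod_(i <- r) F' i).
Proof.
move=> FF; apply: big_ind2 => //; first exact: congr_mod_refl.
by move=> *; exact: congr_modM.
Qed.

Lemma congr_modX f g e : congr_mod f g -> congr_mod (f ^+ e) (g ^+ e).
Proof.
move=> fg; elim: e => [|e IH]; first exact: congr_mod_refl.
by rewrite !exprS; exact: congr_modM.
Qed.

Lemma congr_mod_det m (B C : 'M[A]_m) :
  (forall i j, congr_mod (B i j) (C i j)) -> congr_mod (\det B) (\det C).
Proof.
move=> BC; apply: congr_mod_sum => s.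
by apply: congr_modM; [exact: congr_mod_refl|apply: congr_mod_prod].
Qed.

Lemma congr_mod_mulmx m n p (B B' : 'M[A]_(m, n)) (C C' : 'M[A]_(n, p)) :
  (forall i j, congr_mod (B i j) (B' i j)) ->
  (forall i j, congr_mod (C i j) (C' i j)) ->
  forall i j, congr_mod ((B *m C) i j) ((B' *m C') i j).
Proof. by move=> BB CC i j; rewrite !mxE; apply: congr_mod_sum => l; apply: congr_modM. Qed.

Section CongruentToAdjugate.
Variables (m : nat) (S L : 'M[A]_m).
Hypothesis L_adj : forall i j, congr_mod (L i j) (\adj S i j).

(** Take determinants in [S *m \adj S = (\det S)%:M], then replace [\adj S] by [L]; no division is
    involved. *)
Lemma congr_mod_det_adj : congr_mod (\det S * \det L) (\det S ^+ m).
Proof.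
rewrite -det_scalar -(mul_mx_adj S) det_mulmx.
by apply: congr_modM; [exact: congr_mod_refl|exact: congr_mod_det].
Qed.

(** The two sides are the entries of [\adj L *m \adj S *m S] and [\adj L *m L *m S]. *)
Lemma congr_mod_adj_adj i j : congr_mod (\det S * \adj L i j) (\det L * S i j).
Proof.
have -> : \det L * S i j = (\adj L *m (L *m S)) i j.
  by rewrite mulmxA mul_adj_mx mul_scalar_mx mxE.
have -> : \det S * \adj L i j = (\adj L *m (\adj S *m S)) i j.
  by rewrite mul_adj_mx mul_mx_scalar [RHS]mxE.
apply: congr_mod_mulmx => a b; first exact: congr_mod_refl.
apply: congr_mod_mulmx => c e; last exact: congr_mod_refl.
exact: congr_mod_sym.
Qed.

End CongruentToAdjugate.

End Congruence.

(** * Substituting fractions with a common denominator *)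

Section Homogenization.
Variables (K : fieldType) (N : nat).
Implicit Types (f t : {mpoly K[N]}) (y : 'I_N -> {mpoly K[N]}).

(* This is [t ^ D * f (y / t)] with [D = msize f]. *)
Definition clear_denom f t y : {mpoly K[N]} :=
  \sum_(m <- msupp f) f@_m *: (t ^+ (msize f - mdeg m) * mmap1 y m).

Lemma mmap1_scale (S : comNzRingType) (c : S) (z : 'I_N -> S) (m : 'X_{1..N}) :
  mmap1 (fun i => c * z i) m = c ^+ mdeg m * mmap1 z m.
Proof.
rewrite /mmap1 mdegE -prodrXr -big_split.
by apply: eq_bigr => i _; rewrite exprMn.
Qed.

Lemma meval_clear_denom f t y v : t.@[v] != 0 ->
  (clear_denom f t y).@[v] =
  t.@[v] ^+ msize f * f.@[fun i => (y i).@[v] / t.@[v]].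
Proof.
move=> tN0; rewrite [f.@[_]]mevalE /clear_denom raddf_sum /= mulr_sumr !big_seq.
(* On the support [mdeg m < msize f], so the truncated subtraction in the exponent is a true one. *)
apply: eq_bigr => m /msize_mdeg_lt /ltnW le_m.
rewrite mevalZ mevalM rmorphXn /=.
rewrite [RHS]mulrCA; congr (_ * _).
rewrite -[in RHS](subnK le_m) exprD -mulrA; congr (_ * _).
rewrite -[X in _ = _ * X]/(mmap1 (fun i => (y i).@[v] / t.@[v]) m) -mmap1_scale.
rewrite /mmap1 rmorph_prod; apply: eq_bigr => i _.
by rewrite rmorphXn /= mulrCA divff // mulr1.
Qed.

(** Each monomial of degree e evaluated at [y] is congruent to [t ^+ e] times itself, and the
    padding raises every such power to [t ^+ msize f]. *)
Lemma congr_clear_denom (G : {mpoly K[N]} -> Prop) f t y :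
  (forall i, congr_mod G (y i) (t * 'X_i)) ->
  congr_mod G (clear_denom f t y) (t ^+ msize f * f).
Proof.
move=> yt; rewrite {3}[f]mpolyE mulr_sumr /clear_denom !big_seq.
rewrite /congr_mod -sumrB; apply: ideal_gen_sum => m /msize_mdeg_lt /ltnW le_m.
rewrite -scalerAr -[in X in _ - X](subnK le_m) exprD -mulrA -mmap1_id -mmap1_scale.
rewrite -scalerBr -mul_mpolyC -mulrBr; do 2!apply: ideal_genM.
by apply: congr_mod_prod => i; apply: congr_modX.
Qed.

End Homogenization.

(** * Characterization of reduced Laplacians *)

Section Laplacian.
Variables (n : nat) (E : {set {set 'I_n}}) (k : 'I_n).
Hypothesis hE : simple_graph E.

Lemma adj_sym i j : adj E i j = adj E j i.
Proof. by rewrite /adj setUC. Qed.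

Lemma adj_irrefl i : adj E i i = false.
Proof. by apply/negP => /hE; rewrite setUid cards1. Qed.

Lemma laplacian_sym (K : fieldType) x : (laplacian E x)^T = laplacian E x :> 'M[K]_n.
Proof.
apply/matrixP => i j; rewrite !mxE eq_sym adj_sym setUC.
by case: eqP => // ->.
Qed.

Lemma laplacian_row_sum (K : fieldType) (x : {set 'I_n} -> K) i :
  \sum_j laplacian E x i j = 0.
Proof.
rewrite (bigD1 i) //= mxE eqxx [X in X + _]big_mkcond (bigD1 i) //=.
rewrite adj_irrefl add0r -big_split big1 // => j jNi.
by rewrite mxE eq_sym (negPf jNi); case: ifP; rewrite /= ?subrr ?addr0.
Qed.

Lemma reduced_laplacians_sym (K : fieldType) (B : 'M[K]_n.-1) :
  reduced_laplacians E k B -> B^T = B.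
Proof.
case=> x ->; apply/matrixP => i j; rewrite !mxE.
by have /matrixP/(_ (lift k i) (lift k j)) := laplacian_sym x; rewrite !mxE.
Qed.

Lemma reduced_laplacians_scale (K : fieldType) (c : K) (B : 'M[K]_n.-1) :
  reduced_laplacians E k B -> reduced_laplacians E k (c *: B).
Proof.
case=> x ->; exists (fun e => c * x e); apply/matrixP => i j; rewrite !mxE.
by case: ifP => _; [rewrite mulr_sumr|case: ifP => _; rewrite ?mulrN ?mulr0].
Qed.

Lemma reduced_laplacians_nonadj (K : fieldType) (B : 'M[K]_n.-1) i j :
  reduced_laplacians E k B -> i != j -> ~~ adj E (lift k i) (lift k j) ->
  B i j = 0.
Proof.
by case=> x -> ij nij; rewrite !mxE (inj_eq lift_inj) (negPf ij) (negPf nij).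
Qed.

(** Rows of the full Laplacian sum to zero, and the entry lost with column [k] is zero at a vertex
    not adjacent to [k]. *)
Lemma reduced_laplacians_row_sum (K : fieldType) (B : 'M[K]_n.-1) j :
  reduced_laplacians E k B -> ~~ adj E (lift k j) k -> \sum_i B j i = 0.
Proof.
case=> x -> njk; have := laplacian_row_sum x (lift k j).
rewrite (bigD1_ord k) //= mxE eq_sym (negPf (neq_lift k j)) (negPf njk) add0r => h.
by rewrite -[RHS]h; apply: eq_bigr => i _; rewrite !mxE.
Qed.

(* The reduced Laplacian with weights [x_ij = - B i j] on the edges inside V'
   and [x_ik = \sum_l B i l] on the edges at [k]. *)
Definition laplacian_part (A : comNzRingType) (B : 'M[A]_n.-1) : 'M[A]_n.-1 :=
  \matrix_(i, j)
    if i == j then (if adj E (lift k i) k then \sum_l B i l else 0)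
                   - \sum_(l | adj E (lift k i) (lift k l)) B i l
    else if adj E (lift k i) (lift k j) then B i j else 0.

Lemma map_laplacian_part (A A' : comNzRingType) (phi : {rmorphism A -> A'})
    (B : 'M[A]_n.-1) :
  map_mx phi (laplacian_part B) = laplacian_part (map_mx phi B).
Proof.
apply/matrixP => i j; rewrite !mxE.
case: ifP => _; last by case: ifP => _; rewrite ?rmorph0.
rewrite rmorphB /=; congr (_ - _); last first.
  by rewrite rmorph_sum; apply: eq_bigr => l _; rewrite mxE.
case: ifP => _; rewrite ?rmorph0 // rmorph_sum.
by apply: eq_bigr => l _; rewrite mxE.
Qed.

Lemma set2_inj (T : finType) (a b c d : T) : [set a; b] = [set c; d] ->
  (a = c /\ b = d) \/ (a = d /\ b = c).
Proof.
move=> /setP e.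
have ha := e a; have hb := e b; have hc := e c; have hd := e d.
move: ha hb hc hd; rewrite !inE !eqxx ?orbT /=.
move=> /esym/orP[]/eqP-> /esym/orP[]/eqP-> ; rewrite ?eqxx ?orbT ?orbF; auto.
  by move=> _; rewrite orbb => /eqP ->; left.
by rewrite orbb => /eqP ->; left.
Qed.

Lemma laplacian_partP (K : fieldType) (B : 'M[K]_n.-1) :
  B^T = B -> reduced_laplacians E k (laplacian_part B).
Proof.
move=> symB; have Bsym i j : B i j = B j i by rewrite -[in LHS]symB mxE.
(* Weights must be functions of unordered pairs, so the endpoints are recovered by choice; symmetry
   of [B] makes their order irrelevant. A pair containing [k] falls through to the second case,
   since [lift k] avoids [k]. *)
pose x (e : {set 'I_n}) :=
  if [pick p : 'I_n.-1 * 'I_n.-1 | e == [set lift k p.1; lift k p.2]] is Some p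
  then - B p.1 p.2
  else if [pick i | e == [set lift k i; k]] is Some i then \sum_l B i l else 0.
have x_edge i j : x [set lift k i; lift k j] = - B i j.
  rewrite /x; case: pickP => [[a b]/= /eqP/set2_inj|/(_ (i, j))]; last by rewrite eqxx.
  by case=> [][/lift_inj-> /lift_inj->] //; rewrite Bsym.
have x_root i : x [set lift k i; k] = \sum_l B i l.
  rewrite /x; case: pickP => [[a b]/= /eqP/set2_inj|_].
    by case=> [][_ /eqP]; rewrite (negPf (neq_lift _ _)).
  case: pickP => [a /eqP/set2_inj|/(_ i)]; last by rewrite eqxx.
  case=> [[/lift_inj-> //]|[/eqP]]; by rewrite eq_sym (negPf (neq_lift _ _)).
exists x; apply/matrixP => i j; rewrite !mxE (inj_eq lift_inj).
case: eqP => [_|_]; last by rewrite x_edge opprK.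
rewrite [RHS]big_mkcond [RHS](bigD1_ord k) //= x_root; congr (_ + _).
rewrite -sumrN [LHS]big_mkcond; apply: eq_bigr => l _.
by rewrite x_edge.
Qed.

End Laplacian.

(** * Symmetric matrices as evaluation points *)

Section Points.
Variables (K : fieldType) (m : nat).

Lemma sym_pairC (i j : 'I_m) : sym_pair i j = sym_pair j i.
Proof.
apply: val_inj => /=; case: (ltngtP i j) => // e.
by have -> : i = j by apply: val_inj.
Qed.

Lemma sym_pair_id (p : sym_index m) : sym_pair (val p).1 (val p).2 = p.
Proof. by apply: val_inj; case: p => [[a b]] /= ->. Qed.

Lemma generic_sym_trmx : (generic_sym K m)^T = generic_sym K m.
Proof. by apply/matrixP => i j; rewrite !mxE sym_pairC. Qed.

Lemma generic_sym_enum (u : 'I_(symdim m)) :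
  generic_sym K m (val (enum_val u)).1 (val (enum_val u)).2 = 'X_u.
Proof. by rewrite mxE sym_pair_id enum_valK. Qed.

Definition sym_point (S : 'M[K]_m) (u : 'I_(symdim m)) : K :=
  let p := val (enum_val u) in S p.1 p.2.

Lemma map_generic_sym (S : 'M[K]_m) : S^T = S ->
  map_mx (meval (sym_point S)) (generic_sym K m) = S.
Proof.
move=> symS; apply/matrixP => i j; rewrite !mxE mevalXU /sym_point enum_rankK /=.
by case: ifP => //= _; rewrite -[in RHS]symS mxE.
Qed.

End Points.

(** * The relations on the model, and the two inclusions of ideals *)

Section Relations.
Variables (n : nat) (E : {set {set 'I_n}}) (k : 'I_n).
Hypothesis hE : simple_graph E.

(** Cofactors of [S] are [\det S] times entries of its inverse, so the relations express the zero
    entries and zero row sums of a reduced Laplacian. *)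
Lemma relations_vanish (K : fieldType) (S : 'M[K]_n.-1) g :
  S^T = S -> S \in unitmx -> reduced_laplacians E k (invmx S) ->
  relations E k g -> sym_eval g S = 0.
Proof.
move=> symS uS lapS; rewrite -[sym_eval g S]/(g.@[sym_point S]).
have cofE i j : (cofactor (generic_sym K n.-1) i j).@[sym_point S] =
    \det S * invmx S j i.
  rewrite -cofactor_map_mx map_generic_sym // /invmx uS !mxE mulrA divff ?mul1r //.
  by rewrite -unitfE -unitmxE.
case=> [[i [j [ij nij ->]]]|[j [nj ->]]].
  have := cofE i j; rewrite rmorphM rmorph_sign (reduced_laplacians_nonadj lapS).
  - by rewrite mulr0 => /eqP; rewrite mulf_eq0 signr_eq0 => /eqP.
  - by rewrite eq_sym.
  - by rewrite adj_sym.
rewrite rmorph_sum /=; under eq_bigr do rewrite cofE.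
by rewrite -mulr_sumr (reduced_laplacians_row_sum hE lapS) ?mulr0.
Qed.

Lemma laplacian_part_adj (K : fieldType) i j :
  congr_mod (relations E k) (laplacian_part E k (\adj (generic_sym K n.-1)) i j)
    (\adj (generic_sym K n.-1) i j).
Proof.
set M := \adj _; rewrite /congr_mod mxE.
have M_nonadj l : i != l -> ~~ adj E (lift k i) (lift k l) ->
    ideal_gen (relations E k) (M i l).
  move=> il nil; rewrite mxE; apply: ideal_genM; apply: ideal_gen_sub; left.
  by exists l, i; rewrite eq_sym adj_sym.
have [<-|ij] := eqVneq i j; last first.
  case: ifPn => [_|nij]; first exact: congr_mod_refl.
  by rewrite sub0r; apply/ideal_genN/M_nonadj.
(* On the diagonal, removing the neighbours of [i] and [i] itself from the row sum leaves only
   non-edge entries, which lie in the ideal. *)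
have rest : ideal_gen (relations E k)
    (\sum_l M i l - \sum_(l | adj E (lift k i) (lift k l)) M i l - M i i).
  rewrite (bigID (fun l => adj E (lift k i) (lift k l))) /= [X in X - _]addrAC subrr add0r.
  rewrite (bigD1 i) /= ?adj_irrefl // addrAC subrr add0r.
  by apply: ideal_gen_sum => l /andP[nil li]; apply: M_nonadj => //; rewrite eq_sym.
case: ifPn => // nik.
(* Here the weight of the absent edge to [k] is replaced by 0; the error is the row sum, a relation
   of the second family. *)
rewrite (_ : _ - _ = - \sum_l M i l +
  (\sum_l M i l - \sum_(l | adj E (lift k i) (lift k l)) M i l - M i i)); last by ring.
apply: ideal_genD rest; apply/ideal_genN/ideal_gen_sub; right; exists i; split=> //.
by apply: eq_bigr => l _; rewrite mxE.
Qed.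

Lemma vanishing_saturation (K : numFieldType) (f : sympoly K n.-1) :
  (forall S : 'M[K]_n.-1, S^T = S -> S \in unitmx ->
     reduced_laplacians E k (invmx S) -> sym_eval f S = 0) ->
  saturation (ideal_gen (relations E k)) (\det (generic_sym K n.-1)) f.
Proof.
move=> f0; set Sigma := generic_sym K n.-1; set d := \det Sigma.
set L := laplacian_part E k (\adj Sigma).
(* The factor [d] makes [t] congruent to a power of [d], and makes both [d] and [\det L] nonzero
   wherever [t] is; [y] carries an extra [d] to match. *)
pose t : sympoly K n.-1 := d * \det L.
pose y (u : 'I_(symdim n.-1)) : sympoly K n.-1 := let p := val (enum_val u) in d * (d * \adj L p.1 p.2).
have L_adj i j : congr_mod (relations E k) (L i j) (\adj Sigma i j).
  exact: laplacian_part_adj.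
have t_d : congr_mod (relations E k) t (d ^+ n.-1) by exact: congr_mod_det_adj.
have adjL i j : congr_mod (relations E k) (d * \adj L i j) (\det L * Sigma i j).
  exact: congr_mod_adj_adj.
have y_t u : congr_mod (relations E k) (y u) (t * 'X_u).
  rewrite -generic_sym_enum [X in congr_mod _ _ X](_ : _ =
    d * (\det L * Sigma (val (enum_val u)).1 (val (enum_val u)).2)); last first.
    by rewrite mulrA.
  by apply: congr_modM; [exact: congr_mod_refl|exact: adjL].
(* The extra factor [t] covers the points where the fraction is undefined. *)
have h0 : clear_denom f t y * t = 0.
  apply: mpoly_meval_eq0 => v; rewrite mevalM.
  have [->|tN0] := eqVneq t.@[v] 0; first by rewrite mulr0.
  rewrite meval_clear_denom //.
  pose S := map_mx (meval v) Sigma.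
  have symS : S^T = S by rewrite /S map_trmx generic_sym_trmx.
  pose Lv := laplacian_part E k (\adj S).
  have LvE : map_mx (meval v) L = Lv by rewrite map_laplacian_part map_mx_adj.
  have tE : t.@[v] = \det S * \det Lv by rewrite mevalM -LvE !det_map_mx.
  have lapLv : reduced_laplacians E k Lv.
    by apply: laplacian_partP => //; rewrite trmx_adj symS.
  move: (tN0); rewrite tE mulf_eq0 negb_or => /andP[dS dL].
  have uL : Lv \in unitmx by rewrite unitmxE unitfE.
  have uT : \det S *: invmx Lv \in unitmx by rewrite unitmxZ ?unitfE // unitmx_inv.
  (* The values of [y / t] are the coordinates of [\det S *: invmx Lv], whose inverse is a multiple
     of the reduced Laplacian [Lv], so [f] vanishes there. *)
  rewrite [X in _ * X * _](_ : _ = 0) ?mulr0 ?mul0r //.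
  rewrite -[RHS](f0 (\det S *: invmx Lv)) //.
  - apply: meval_eq => u; rewrite /y !mevalM -det_map_mx -/S.
    rewrite [(\adj L _ _).@[v]](_ : _ = \adj Lv (val (enum_val u)).1 (val (enum_val u)).2).
      rewrite /invmx uL !mxE; field; exact/andP.
    by rewrite -LvE -map_mx_adj [RHS]mxE.
  - by rewrite linearZ /= trmx_inv (reduced_laplacians_sym lapLv).
  - by rewrite invmxZ // invmxK; apply: reduced_laplacians_scale.
(* Clearing denominators costs [msize f] factors [t], [h0] costs one more, and each [t] is congruent
   to [d ^+ n.-1]. *)
exists (n.-1 * (msize f).+1)%N; rewrite exprM.
apply: (congr_mod_ideal (f := t ^+ (msize f).+1 * f)).
  by apply: congr_modM; [exact: congr_modX|exact: congr_mod_refl].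
rewrite exprS -mulrA mulrC; apply: (congr_mod_ideal (f := clear_denom f t y * t)).
  by apply: congr_modM; [exact: congr_clear_denom|exact: congr_mod_refl].
by rewrite h0; exact: ideal_gen0.
Qed.

End Relations.

Theorem theorem2p18 (R : realType) (n : nat) (E : {set {set 'I_n}})
    (k : 'I_n) (hn : (2 <= n)%N) (hE : simple_graph E)
    (hconn : connected_graph E) (f : sympoly R[i] n.-1) :
  vanishing_ideal (covariance_model E k) f <->
  saturation (ideal_gen (relations E k)) (\det (generic_sym R[i] n.-1)) f.
Proof.
split=> [f0|[e [s [sG def]]] S clS].
  apply: vanishing_saturation => // S symS uS lapS; apply: f0 => F XF.
  by apply: XF.
suff /(_ f erefl) : forall g, g = f -> sym_eval g S = 0 by [].
(* The closure is tested against the zero locus of [f] alone, which leaves only invertible points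
   [T], where the power of the determinant can be cancelled. *)
apply: (clS (fun g => g = f) _).2 => T [symT uT lapT]; split=> // _ ->.
have phi0 : sym_eval (\det (generic_sym R[i] n.-1) ^+ e * f) T = 0.
  rewrite def /sym_eval rmorph_sum big_seq big1 // => p /sG p_rel.
  by rewrite rmorphM /= [X in _ * X](relations_vanish hE symT uT lapT p_rel) mulr0.
move: phi0; rewrite /sym_eval -/(sym_point T) mevalM rmorphXn /= -det_map_mx.
rewrite map_generic_sym // => /eqP; rewrite mulf_eq0 expf_eq0.
by move: uT; rewrite unitmxE unitfE => /negPf ->; rewrite andbF => /eqP.
Qed.
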